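(* Let $\mathcal{K}$ be a class of metric algebras (closed under isomorphism). Then $\mathcal{K}$ is defined by a continuous family of basic quantitative inferences (i.e. there is a continuous family $\Phi$ of metric implications, each of which is a basic quantitative inference, such that $\mathcal{K}$ is exactly the class of all metric algebras $A$ with $A \models \Phi$) if and only if $\mathcal{K}$ is closed under subalgebras, products, reflexive quotients and ultraproducts.
   Context: Fix an algebraic signature $\Sigma$ (operation symbols with finite arities; $\Sigma_n$ the $n$-ary ones). A metric algebra is a $\Sigma$-algebra $A$ together with an extended metric $d\colon A\times A\to[0,\infty]$ (so $d(x,y)=0\iff x=y$, symmetry, triangle inequality; infinite distances allowed); no compatibility between metric and operations is required. A homomorphism is a map that is a $\Sigma$-homomorphism and non-expansive ($d(f(x),f(y))\le d(x,y)$). A subalgebra is a subset closed under the operations, with the restricted metric. The product of a family $(A_i)_{i\in I}$ is the product $\Sigma$-algebra with the supremum metric $d((x_i),(y_i))=\sup_i d_i(x_i,y_i)$. A quotient of $A$ is a surjective homomorphism $p\colon A\to B$; it is reflexive if there is a subset $A'\subseteq A$ such that $p|_{A'}\colon A'\to B$ is a bijective isometry. Classes of metric algebras are assumed closed under isomorphism. Ultraproducts: for a filter $\mathcal F$ on a nonempty set $I$ and metric algebras $(A_i)_{i\in I}$, let $\theta((x_i),(y_i))=\inf_{J\in\mathcal F}\sup_{i\in J} d_i(x_i,y_i)$ on $\prod_i A_i$. The reduced product by $\mathcal F$ exists if the relation $\theta(x,y)=0$ is a congruence of the $\Sigma$-algebra $\prod_i A_i$; it is then the quotient set $\prod_i A_i/\{\theta=0\}$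 with metric induced by $\theta$ and operations induced from the product. When $\mathcal F$ is an ultrafilter it is called an ultraproduct. A class is closed under ultraproducts if for every nonempty $I$, every ultrafilter on $I$ and every family in the class indexed by $I$, the ultraproduct exists and lies in the class. Syntax: for a set $X$ of variables and $\Sigma$-terms $s,t$ over $X$ and $\varepsilon\ge 0$, $s=_\varepsilon t$ is a metric equation. A metric implication is $\bigwedge_{i=1}^n s_i=_{\varepsilon_i} t_i \to s=_\varepsilon t$ ($n\ge 0$); it is a basic quantitative inference if all $s_i,t_i$ are variables. For $v\colon X\to A$, $A,v\models s=_\varepsilon t$ means $d(\llbracket s\rrbracket_v,\llbracket t\rrbracket_v)\le\varepsilon$, where $\llbracket\cdot\rrbracket_v$ is the homomorphic extension of $v$ to terms; $A\models\phi$ for an implication $\phi$ means that for every $v$, if all premises hold under $v$ then the conclusion does. A continuous family of metric implications is a set $\Phi$ of metric implications such that (i) for each $\sigma\in\Sigma_n$ the implication $\bigwedge_{k=1}^n x_k=_0 y_k\to \sigma(x_1,\dots,x_n)=_0\sigma(y_1,\dots,y_n)$ belongs to $\Phi$; (ii) whenever $\bigwedge_{i=1}^n s_i=_{\varepsilon_i}t_i\to s=_\varepsilon t$ is in $\Phi$ and $\varepsilon'>\varepsilon$, there is $\delta>0$ such that $\bigwedge_{i=1}^n s_i=_{\varepsilon_i+\delta}t_i\to s=_{\varepsilon'} t$ is in $\Phi$. *)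

(* Defs.v *)
From HB Require Import structures.
From mathcomp Require Import all_boot all_order all_algebra.
From mathcomp Require Import generic_quotient.
From mathcomp Require Import all_classical all_reals interval_inference ereal.

Set Implicit Arguments.
Unset Strict Implicit.
Unset Printing Implicit Defensive.

Import Order.TTheory GRing.Theory Num.Theory.
Local Open Scope quotient_scope.
Local Open Scope classical_set_scope.
Local Open Scope ring_scope.

Record signature := Signature { op : Type; arity : op -> nat }.

(* The carrier may be empty (possible only if there are no constants). *)
Record algebra (S : signature) := Algebra {
  carrier :> Type;
  oper : forall o : op S, ('I_(arity o) -> carrier) -> carrier }.

Record metric_algebra (R : realType) (S : signature) := MetricAlgebra {
  alg :> algebra S;
  dist : alg -> alg -> \bar R;
  dist_ge0 : forall x y, (0 <= dist x y)%E;
  dist_eq0 : forall x y, dist x y = 0%E <-> x = y;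
  dist_sym : forall x y, dist x y = dist y x;
  dist_triangle : forall x y z, (dist x z <= dist x y + dist y z)%E }.

(* Supremum in [0, +oo]: the point 0 is added because [ereal_sup set0] is -oo,
   whereas an empty supremum of distances is 0. *)
Definition dsup (R : realType) (I : Type) (J : set I) (f : I -> \bar R) :
  \bar R := ereal_sup (0%E |` (f @` J)).

Section DSup.
Context {R : realType} {I : Type}.
Implicit Types (J K : set I) (f g : I -> \bar R).

Lemma dsup_ge0 J f : (0 <= dsup J f)%E.
Proof. by apply: ereal_sup_ubound; left. Qed.

Lemma dsup_ub J f i : J i -> (f i <= dsup J f)%E.
Proof. by move=> Ji; apply: ereal_sup_ubound; right; exists i. Qed.

Lemma dsup_le J f (b : \bar R) :
  (0 <= b)%E -> (forall i, J i -> (f i <= b)%E) -> (dsup J f <= b)%E.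
Proof.
by move=> b0 fb; apply: ge_ereal_sup => _ [->//|[i Ji <-]]; exact: fb.
Qed.

Lemma dsup_sub J K f : J `<=` K -> (dsup J f <= dsup K f)%E.
Proof.
by move=> JK; apply: dsup_le (dsup_ge0 _ _) _ => i /JK; exact: dsup_ub.
Qed.

End DSup.

Section Morphisms.
Context {R : realType} {S : signature}.
Implicit Types A B : metric_algebra R S.

Definition homomorphism A B (f : A -> B) : Prop :=
  (forall (o : op S) (a : 'I_(arity o) -> A),
     f (oper a) = oper (fun k => f (a k))) /\
  (forall x y, (dist (f x) (f y) <= dist x y)%E).

Definition isomorphic A B : Prop :=
  exists (f : A -> B) (g : B -> A),
    [/\ homomorphism f, homomorphism g, cancel f g & cancel g f].

Definition quotient A B (p : A -> B) : Prop :=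
  homomorphism p /\ set_surj [set: A] [set: B] p.

Definition reflexive_quotient A B (p : A -> B) : Prop :=
  quotient p /\
  exists A' : set A,
    set_bij A' [set: B] p /\
    (forall x y, A' x -> A' y -> dist (p x) (p y) = dist x y).

End Morphisms.

Section Subalgebra.
Context {R : realType} {S : signature} (A : metric_algebra R S) (B : set A).

Definition op_closed : Prop :=
  forall (o : op S) (a : 'I_(arity o) -> A), (forall k, B (a k)) -> B (oper a).

Hypothesis Bop : op_closed.

Definition sub_oper (o : op S) (a : 'I_(arity o) -> B) : B :=
  SigSub (mem_set (Bop (fun k => set_mem (valP (a k))))).

Definition sub_dist (x y : B) : \bar R := dist (val x) (val y).

Lemma sub_dist_eq0 x y : sub_dist x y = 0%E <-> x = y.
Proof.
split=> [/dist_eq0|->]; first exact: val_inj.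
exact/dist_eq0.
Qed.

Definition subalgebra : metric_algebra R S :=
  @MetricAlgebra R S (Algebra sub_oper) sub_dist
    (fun x y => dist_ge0 (val x) (val y)) sub_dist_eq0
    (fun x y => dist_sym (val x) (val y))
    (fun x y z => dist_triangle (val x) (val y) (val z)).

End Subalgebra.

Section Product.
Context {R : realType} {S : signature} {I : Type} (A : I -> metric_algebra R S).

Definition product_algebra : algebra S :=
  @Algebra S (forall i, A i) (fun o a => fun i => oper (fun k => a k i)).

Implicit Types x y z : product_algebra.

Definition product_dist x y : \bar R :=
  dsup [set: I] (fun i => dist (x i) (y i)).

Lemma product_dist_eq0 x y : product_dist x y = 0%E <-> x = y.
Proof.
split=> [xy0|->].
  apply: functional_extensionality_dep => i; apply/dist_eq0/eqP.
  rewrite eq_le dist_ge0 andbT -xy0.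
  exact: (@dsup_ub _ _ setT (fun i => dist (x i) (y i))).
apply/eqP; rewrite eq_le dsup_ge0 andbT; apply: dsup_le => // i _.
by have /dist_eq0 -> : y i = y i by [].
Qed.

Lemma product_dist_sym x y : product_dist x y = product_dist y x.
Proof.
by congr dsup; apply: functional_extensionality_dep => i; exact: dist_sym.
Qed.

Lemma product_dist_triangle x y z :
  (product_dist x z <= product_dist x y + product_dist y z)%E.
Proof.
apply: dsup_le => [|i _]; first by rewrite adde_ge0 ?dsup_ge0.
apply: le_trans (dist_triangle _ (y i) _) _.
by apply: leeD; [exact: (@dsup_ub _ _ setT (fun i => dist (x i) (y i)))
                |exact: (@dsup_ub _ _ setT (fun i => dist (y i) (z i)))].
Qed.

Definition product : metric_algebra R S :=
  @MetricAlgebra R S product_algebra product_dist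
    (fun x y => dsup_ge0 _ _) product_dist_eq0
    product_dist_sym product_dist_triangle.

End Product.

Definition congruence (S : signature) (A : algebra S) (r : A -> A -> Prop) :
    Prop :=
  RelationClasses.Equivalence r /\
  forall (o : op S) (a b : 'I_(arity o) -> A),
    (forall k, r (a k) (b k)) -> r (oper a) (oper b).

Section ReducedProduct.
Context {R : realType} {S : signature} {I : Type}.
Context (F : set_system I) {FF : Filter F} (A : I -> metric_algebra R S).

Implicit Types x y z : product_algebra A.

Definition theta x y : \bar R :=
  ereal_inf [set dsup J (fun i => dist (x i) (y i)) | J in F].

Lemma theta_le x y J : F J -> (theta x y <= dsup J (fun i => dist (x i) (y i)))%E.
Proof. by move=> FJ; apply: ereal_inf_lbound; exists J. Qed.

Lemma theta_ge0 x y : (0 <= theta x y)%E.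
Proof. by apply: le_ereal_inf_tmp => _ [J _ <-]; exact: dsup_ge0. Qed.

Lemma theta_refl x : theta x x = 0%E.
Proof.
apply/eqP; rewrite eq_le theta_ge0 andbT.
apply: le_trans (theta_le _ _ filterT) _; apply: dsup_le => // i _.
by have /dist_eq0 -> : x i = x i by [].
Qed.

Lemma theta_sym x y : theta x y = theta y x.
Proof.
rewrite /theta; congr ereal_inf; congr image.
apply: functional_extensionality_dep => J; congr dsup.
by apply: functional_extensionality_dep => i; exact: dist_sym.
Qed.

Lemma theta_triangle x y z : (theta x z <= theta x y + theta y z)%E.
Proof.
have key J K : F J -> F K -> (theta x z <=
    dsup J (fun i => dist (x i) (y i)) + dsup K (fun i => dist (y i) (z i)))%E.
  move=> FJ FK; apply: le_trans (theta_le _ _ (filterI FJ FK)) _.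
  apply: dsup_le => [|i [Ji Ki]]; first by rewrite adde_ge0 ?dsup_ge0.
  apply: le_trans (dist_triangle _ (y i) _) _.
  by apply: leeD; [exact: (@dsup_ub _ _ J (fun i => dist (x i) (y i)))
                  |exact: (@dsup_ub _ _ K (fun i => dist (y i) (z i)))].
have [->|xyoo] := eqVneq (theta x y) +oo%E.
  by rewrite addye ?leey// gt_eqF// (lt_le_trans _ (theta_ge0 _ _)) ?ltNy0.
have [->|yzoo] := eqVneq (theta y z) +oo%E.
  by rewrite addey ?leey// gt_eqF// (lt_le_trans _ (theta_ge0 _ _)) ?ltNy0.
have fxy : theta x y \is a fin_num by rewrite ge0_fin_numE ?theta_ge0// ltey.
have fyz : theta y z \is a fin_num by rewrite ge0_fin_numE ?theta_ge0// ltey.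
apply/lee_addgt0Pr => e e0.
have e20 : (0 < e / 2) by rewrite divr_gt0.
have [_ [J FJ <-] Je] := lb_ereal_inf_adherent e20 fxy.
have [_ [K FK <-] Ke] := lb_ereal_inf_adherent e20 fyz.
apply: le_trans (key _ _ FJ FK) _.
apply: le_trans (leeD (ltW Je) (ltW Ke)) _.
by rewrite addeACA -EFinD -splitr.
Qed.

(* The elements of the product form a choice type only classically, hence the
   use of [{classic _}] to take the quotient. *)
Definition theta_eq0 : rel {classic forall i, A i} :=
  fun x y => theta x y == 0%E.

Lemma theta_eq0_refl : reflexive theta_eq0.
Proof. by move=> x; apply/eqP; exact: theta_refl. Qed.

Lemma theta_eq0_sym : symmetric theta_eq0.
Proof. by move=> x y; rewrite /theta_eq0 theta_sym. Qed.

Lemma theta_eq0_trans : transitive theta_eq0.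
Proof.
move=> y x z /eqP xy /eqP yz; apply/eqP/eqP.
by rewrite eq_le theta_ge0 andbT (le_trans (theta_triangle x y z))// xy yz adde0.
Qed.

Canonical theta_equiv :=
  EquivRel theta_eq0 theta_eq0_refl theta_eq0_sym theta_eq0_trans.

Definition reduced_carrier : Type := {eq_quot theta_equiv}.

Definition reduced_class x : reduced_carrier := \pi_({eq_quot theta_equiv})%qT x.

Definition reduced_repr (u : reduced_carrier) : product_algebra A :=
  repr (u : {eq_quot theta_equiv}).

Lemma reduced_reprK : cancel reduced_repr reduced_class.
Proof. by move=> u; exact: reprK. Qed.

Lemma reduced_classP x y : reduced_class x = reduced_class y <-> theta x y = 0%E.
Proof.
split=> [/eqmodP/eqP//|xy0]; apply/eqmodP; exact/eqP.
Qed.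

Lemma theta_repr_class x : theta (reduced_repr (reduced_class x)) x = 0%E.
Proof. by apply/reduced_classP; exact: reduced_reprK. Qed.

Definition reduced_oper (o : op S) (a : 'I_(arity o) -> reduced_carrier) :
    reduced_carrier :=
  reduced_class (oper (fun k => reduced_repr (a k))).

Definition reduced_dist (u v : reduced_carrier) : \bar R :=
  theta (reduced_repr u) (reduced_repr v).

Lemma reduced_dist_eq0 u v : reduced_dist u v = 0%E <-> u = v.
Proof.
rewrite -{2}[u]reduced_reprK -{2}[v]reduced_reprK.
by split=> [/reduced_classP|/reduced_classP].
Qed.

Lemma reduced_dist_class x y :
  reduced_dist (reduced_class x) (reduced_class y) = theta x y.
Proof.
have le x1 y1 x2 y2 : theta x1 x2 = 0%E -> theta y1 y2 = 0%E ->
    (theta x1 y1 <= theta x2 y2)%E.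
  move=> x0 y0; apply: le_trans (theta_triangle _ x2 _) _.
  rewrite x0 add0e; apply: le_trans (theta_triangle _ y2 _) _.
  by rewrite (theta_sym y2) y0 adde0.
by apply/eqP; rewrite eq_le; apply/andP; split; apply: le;
  rewrite ?theta_repr_class// theta_sym theta_repr_class.
Qed.

Definition reduced_product_exists : Prop :=
  congruence (A := product_algebra A) (fun x y => theta x y = 0%E).

(* [reduced_oper] is computed on representatives; only under the congruence
   hypothesis is it the operation induced by the product. *)
Lemma reduced_oper_class (o : op S) (a : 'I_(arity o) -> product_algebra A) :
  reduced_product_exists ->
  reduced_oper (fun k => reduced_class (a k)) = reduced_class (oper a).
Proof.
move=> [_ cong]; apply/reduced_classP.
by apply: cong => k; exact: theta_repr_class.
Qed.

Definition reduced_product : metric_algebra R S :=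
  @MetricAlgebra R S (Algebra reduced_oper) reduced_dist
    (fun u v => theta_ge0 _ _) reduced_dist_eq0
    (fun u v => theta_sym _ _) (fun u v w => theta_triangle _ _ _).

End ReducedProduct.

Arguments reduced_product {R S I} F {FF} A.

Section Closure.
Context {R : realType} {S : signature} (K : metric_algebra R S -> Prop).

Definition closed_under_isomorphism : Prop :=
  forall A B : metric_algebra R S, isomorphic A B -> K A -> K B.

Definition closed_under_subalgebras : Prop :=
  forall (A : metric_algebra R S) (B : set A) (Bop : op_closed B),
    K A -> K (subalgebra Bop).

Definition closed_under_products : Prop :=
  forall (I : Type) (A : I -> metric_algebra R S),
    (forall i, K (A i)) -> K (product A).

Definition closed_under_reflexive_quotients : Prop :=
  forall (A B : metric_algebra R S) (p : A -> B),
    reflexive_quotient p -> K A -> K B.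

Definition closed_under_ultraproducts : Prop :=
  forall (I : Type) (F : set_system I) (UF : UltraFilter F)
         (A : I -> metric_algebra R S),
    inhabited I -> (forall i, K (A i)) ->
    reduced_product_exists F A /\ K (reduced_product F A).

End Closure.

Inductive term (S : signature) (X : Type) : Type :=
| Var of X
| App (o : op S) of ('I_(arity o) -> term S X).

Arguments Var {S X} x.
Arguments App {S X} o t.

Definition is_var (S : signature) (X : Type) (t : term S X) : bool :=
  if t is Var _ then true else false.

Fixpoint eval (S : signature) (X : Type) (A : algebra S) (v : X -> A)
    (t : term S X) : A :=
  match t with
  | Var x => v x
  | App o s => oper (fun k => eval v (s k))
  end.

Section Syntax.
Variables (R : realType) (S : signature).

Record metric_equation (X : Type) := MetricEquation {
  lhs : term S X;
  bound : {nonneg R};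
  rhs : term S X }.

Record metric_implication (X : Type) := MetricImplication {
  npremises : nat;
  premise : 'I_npremises -> metric_equation X;
  conclusion : metric_equation X }.

End Syntax.

Arguments premise {R S X} _ _.

Section Semantics.
Context {R : realType} {S : signature}.

Definition equation_holds (X : Type) (A : metric_algebra R S) (v : X -> A)
    (e : metric_equation R S X) : Prop :=
  (dist (eval v (lhs e)) (eval v (rhs e)) <= (bound e)%:num%:E)%E.

Definition satisfies (X : Type) (A : metric_algebra R S)
    (phi : metric_implication R S X) : Prop :=
  forall v : X -> A,
    (forall i, equation_holds v (premise phi i)) ->
    equation_holds v (conclusion phi).

Definition basic_quantitative_inference (X : Type)
    (phi : metric_implication R S X) : Prop :=
  forall i, is_var (lhs (premise phi i)) && is_var (rhs (premise phi i)).

Definition relax (X : Type) (d : {nonneg R}) (e : metric_equation R S X) :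
    metric_equation R S X :=
  MetricEquation (lhs e) ((bound e)%:num + d%:num)%:nng (rhs e).

(* Implications are finitary, so a countable set of variables suffices: it is
   taken to be [nat].  The pairwise distinct variables x_k and y_k are numbered
   2k and 2k+1. *)
Definition op_congruence (o : op S) : metric_implication R S nat :=
  MetricImplication
    (fun k : 'I_(arity o) =>
       MetricEquation (Var (k.*2)%N) 0%:nng (Var (k.*2.+1)%N))
    (MetricEquation (App o (fun k => Var (k.*2)%N)) 0%:nng
                    (App o (fun k => Var (k.*2.+1)%N))).

Definition continuous_family (Phi : set (metric_implication R S nat)) : Prop :=
  (forall o : op S, Phi (op_congruence o)) /\
  (forall (n : nat) (prem : 'I_n -> metric_equation R S nat)
          (s t : term S nat) (eps eps' : {nonneg R}),
     Phi (MetricImplication prem (MetricEquation s eps t)) ->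
     eps%:num < eps'%:num ->
     exists d : {nonneg R}, 0 < d%:num /\
       Phi (MetricImplication (fun i => relax d (prem i))
                              (MetricEquation s eps' t))).

Definition defined_by (K : metric_algebra R S -> Prop)
    (Phi : set (metric_implication R S nat)) : Prop :=
  forall A : metric_algebra R S, K A <-> (forall phi, Phi phi -> satisfies A phi).

End Semantics.

(* Main.v *)
(** Soundness is direct; for ultraproducts, continuity turns a bound on theta
    into premises that hold with slack on a single set of the filter.
    Conversely, let Phi be the set of all basic quantitative inferences valid
    in K.  An ultraproduct of counterexamples with slack 1/(m+1) shows that Phi
    is continuous.  Let A satisfy Phi, and let s, t be terms over the set of
    variables A with e < d(s, t) in A.  Each finite part of the metric diagram
    of A can be realized in a member of K with e < d(s, t) still true, since
    otherwise an inference of Phi would fail in A; an ultraproduct over the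
    finite parts gives a nonexpansive map from A to a member of K that keeps
    s and t more than e apart.  The product of these maps over all (s, t, e)
    embeds A isometrically as a generating set of a subalgebra of a product of
    members of K, and evaluation of terms maps this subalgebra onto A as a
    reflexive quotient. *)

Require Import Defs.
From mathcomp Require Import all_boot all_order all_algebra.
From mathcomp Require Import all_classical all_reals.
From mathcomp Require Import interval_inference.
From mathcomp Require ereal.

Set Implicit Arguments.
Unset Strict Implicit.
Unset Printing Implicit Defensive.

Import Order.TTheory GRing.Theory Num.Theory.
Local Open Scope classical_set_scope.
Local Open Scope ring_scope.

(** * Evaluation, renaming and variables of terms *)

Section Terms.
Context {S : signature}.

Lemma eval_morph (X : Type) (A B : algebra S) (f : A -> B)
    (fM : forall (o : op S) (a : 'I_(arity o) -> A),
       f (oper a) = oper (fun k => f (a k))) (v : X -> A) (t : term S X) :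
  f (eval v t) = eval (f \o v) t.
Proof.
by elim: t => //= o s IH; rewrite fM; congr oper; apply/funext.
Qed.

(** Renaming is evaluation in the term algebra, which makes [eval_rename] an instance of
    [eval_morph]. *)
Definition rename (X Y : Type) (h : X -> Y) : term S X -> term S Y :=
  eval (A := Algebra (@App S Y)) (Var \o h).

Lemma eval_rename (X Y : Type) (A : algebra S) (h : X -> Y) (v : Y -> A) t :
  eval v (rename h t) = eval (v \o h) t.
Proof. exact: (@eval_morph _ (Algebra (@App S Y)) A (eval v)). Qed.

Fixpoint vars (X : Type) (t : term S X) : seq X :=
  match t with
  | Var x => [:: x]
  | App o s => flatten [seq vars (s k) | k <- enum 'I_(arity o)]
  end.

(** Serves to replace the elements of an algebra, used as variables, by finitely many numbered
    variables. *)
Lemma eq_eval_in (X : eqType) (A : algebra S) (v w : X -> A) (t : term S X) :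
  {in vars t, v =1 w} -> eval v t = eval w t.
Proof.
elim: t => [x|o s IH] vw /=; first by apply: vw; rewrite inE.
congr oper; apply/funext => k; apply: IH => x xk; apply: vw.
by apply/flatten_mapP; exists k; rewrite ?mem_enum.
Qed.

End Terms.

(** * Soundness for subalgebras, products and reflexive quotients *)

Section Preservation.
Context {R : realType} {S : signature}.

Lemma satisfies_subalgebra (X : Type) (phi : metric_implication R S X)
    (A : metric_algebra R S) (B : set A) (Bop : op_closed B) :
  satisfies A phi -> satisfies (subalgebra Bop) phi.
Proof.
move=> Aphi v; have valE t : val (eval v t) = eval (A := A) (val \o v) t.
  exact: (@eval_morph _ _ (subalgebra Bop) A).
rewrite /equation_holds /= /sub_dist valE valE => vP.
by apply: Aphi => i; move: (vP i); rewrite valE valE.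
Qed.

Lemma satisfies_product (X : Type) (phi : metric_implication R S X)
    (I : Type) (A : I -> metric_algebra R S) :
  (forall i, satisfies (A i) phi) -> satisfies (product A) phi.
Proof.
move=> Aphi v vP.
have projE i t : eval v t i = eval (fun x => v x i) t.
  exact: (@eval_morph _ _ (product A) (A i) (fun x => x i)).
apply: dsup_le => // i _; rewrite projE projE; apply: Aphi => j.
rewrite /equation_holds -!projE; apply: le_trans (vP j).
exact: (@dsup_ub _ _ setT (fun i => dist (eval v _ i) (eval v _ i))).
Qed.

(** A valuation in [B] is lifted along the isometric section [g] of [p]. Since the premises compare
    variables only, lifting keeps their distances; the conclusion comes back to [B] because [p] is
    nonexpansive. *)
Lemma satisfies_reflexive_quotient (X : Type) (phi : metric_implication R S X)
    (A B : metric_algebra R S) (p : A -> B) :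
  basic_quantitative_inference phi -> reflexive_quotient p ->
  satisfies A phi -> satisfies B phi.
Proof.
move=> basic [[[pM pd] _] [A' [[_ _ psurj] piso]]] Aphi v vP.
have /choice[g gP] : forall b : B, exists a : A, A' a /\ p a = b.
  by move=> b; have [a A'a <-] := psurj b I; exists a.
have vE t : eval v t = p (eval (g \o v) t).
  rewrite (eval_morph (A := A) (B := B))//; congr eval.
  by apply/funext => x /=; rewrite (gP _).2.
rewrite /equation_holds !vE; apply: le_trans (pd _ _) _; apply: Aphi => i.
have := vP i; have := basic i; rewrite /equation_holds.
case: (lhs _) => //= x; case: (rhs _) => //= y _.
by rewrite -(piso _ _ (gP _).1 (gP _).1) !(gP _).2.
Qed.

End Preservation.

(** * Reading [theta] on sets of the filter *)

Section Theta.
Context {R : realType} {S : signature} {I : Type}.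
Context (F : set_system I) {FF : Filter F} (A : I -> metric_algebra R S).
Implicit Types (x y : product_algebra A) (b : \bar R).
Local Open Scope ereal_scope.

Lemma theta_lt x y b : theta F x y < b -> F [set i | dist (x i) (y i) < b].
Proof.
move=> /ereal.ereal_inf_lt[_ [J FJ <-]] Jb; apply: filterS FJ => i Ji.
by apply: le_lt_trans Jb; exact: (@dsup_ub _ _ J (fun i => dist (x i) (y i))).
Qed.

Lemma theta_le_near x y b :
  0 <= b -> F [set i | dist (x i) (y i) <= b] -> theta F x y <= b.
Proof. by move=> b0 Fb; apply: le_trans (theta_le _ _ Fb) _; apply: dsup_le. Qed.

Lemma theta_gt_near x y b :
  ~ F set0 -> F [set i | b < dist (x i) (y i)] -> b <= theta F x y.
Proof.
move=> F0 Fb; rewrite leNgt; apply/negP => /theta_lt Flt; apply: F0.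
apply: filterS (filterI Fb Flt) => i [/= bi ib].
by have := lt_trans bi ib; rewrite ltxx.
Qed.

Lemma reduced_dist_eval (X : Type) (w : forall i, X -> A i) (s t : term S X) :
  reduced_product_exists F A ->
  let v : X -> reduced_product F A := fun z => reduced_class (fun i => w i z) in
  dist (eval v s) (eval v t) =
  theta F (fun i => eval (w i) s) (fun i => eval (w i) t).
Proof.
move=> ex v.
have piM (o : op S) (a : 'I_(arity o) -> product_algebra A) :
    reduced_class (oper a) = oper (a := reduced_product F A)
      (fun k => reduced_class (a k)).
  by rewrite -reduced_oper_class.
have vE u : eval v u = reduced_class (fun i => eval (w i) u).
  rewrite -[LHS](eval_morph (B := reduced_product F A) piM
    (fun z i => w i z)); congr reduced_class.
  apply: functional_extensionality_dep => i.
  exact: (@eval_morph _ _ (product_algebra A) (A i) (fun x => x i)).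
by rewrite vE vE; exact: reduced_dist_class.
Qed.

End Theta.

(** * Soundness for ultraproducts *)

Section ContinuousFamily.
Context {R : realType} {S : signature}.
Context (Phi : set (metric_implication R S nat)) (PhiC : continuous_family Phi).
Context {I : Type} (F : set_system I) {FF : Filter F}.
Context (A : I -> metric_algebra R S).
Hypothesis APhi : forall i phi, Phi phi -> satisfies (A i) phi.

(** Stated for [theta] on the product rather than for the quotient, so that it can also prove that
    the reduced product exists. *)
Lemma continuous_family_theta (phi : metric_implication R S nat)
    (w : forall i, nat -> A i) : Phi phi ->
  (forall j, theta F (fun i => eval (w i) (lhs (premise phi j)))
      (fun i => eval (w i) (rhs (premise phi j))) <=
      (bound (premise phi j))%:num%:E)%E ->
  (theta F (fun i => eval (w i) (lhs (conclusion phi)))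
      (fun i => eval (w i) (rhs (conclusion phi))) <=
      (bound (conclusion phi))%:num%:E)%E.
Proof.
case: phi => n prem [s eps t] /= Phiphi premP.
apply/lee_addgt0Pr => e e0.
have e'0 : 0 <= eps%:num + e by rewrite addr_ge0// ltW.
have [|d [d0 Phid]] := PhiC.2 _ _ _ _ _ (NngNum e'0) Phiphi.
  by rewrite ltrDl.
apply: theta_le_near; first by rewrite -EFinD lee_fin.
(* There are finitely many premises, so their sets in the filter have an intersection in the
   filter. *)
have : F [set i | forall j, equation_holds (w i) (relax d (prem j))].
  apply: filter_forall => j.
  have /theta_lt : (theta F (fun i => eval (w i) (lhs (prem j)))
      (fun i => eval (w i) (rhs (prem j))) <
      ((bound (prem j))%:num + d%:num)%:E)%E.
    by apply: le_lt_trans (premP j) _; rewrite lte_fin ltrDl.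
  by apply: filterS => i /= /ltW.
by apply: filterS => i /= /(APhi Phid).
Qed.

Lemma continuous_family_reduced_exists : reduced_product_exists F A.
Proof.
split.
  split=> [x|x y|x y z]; first exact: theta_refl.
    by rewrite theta_sym.
  move=> xy yz; apply/eqP; rewrite eq_le theta_ge0 andbT.
  by rewrite (le_trans (theta_triangle x y z))// xy yz adde0.
move=> o a b ab.
(* A constant has only the empty tuple of arguments; a positive arity is what the modulus in [w]
   requires. *)
have [ar0|ar0] := posnP (arity o).
  suff -> : a = b by exact: theta_refl.
  by apply/funext => -[k kP]; exfalso; rewrite ar0 in kP.
(* [op_congruence] numbers x_k and y_k as 2k and 2k+1; the reduction modulo the
   arity only serves to make [w] total. *)
pose w i n := if odd n then b (Ordinal (ltn_pmod n./2 ar0)) i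
              else a (Ordinal (ltn_pmod n./2 ar0)) i.
have wE i (k : 'I_(arity o)) : (w i k.*2 = a k i) * (w i k.*2.+1 = b k i).
  rewrite /w /= odd_double /= uphalf_double doubleK.
  have -> : Ordinal (ltn_pmod k ar0) = k by apply: val_inj; rewrite /= modn_small.
  by [].
have := continuous_family_theta (w := w) (PhiC.1 o).
rewrite /=.
have -> : (fun i => oper (fun k : 'I_(arity o) => w i k.*2)) = oper a.
  by apply: functional_extensionality_dep => i; congr oper; apply/funext => k;
    rewrite wE.
have -> : (fun i => oper (fun k : 'I_(arity o) => w i k.*2.+1)) = oper b.
  by apply: functional_extensionality_dep => i; congr oper; apply/funext => k;
    rewrite wE.
move=> H; apply/eqP; rewrite eq_le theta_ge0 andbT H// => k.
have -> : (fun i => w i k.*2) = a k.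
  by apply: functional_extensionality_dep => i; rewrite wE.
have -> : (fun i => w i k.*2.+1) = b k.
  by apply: functional_extensionality_dep => i; rewrite wE.
by rewrite ab.
Qed.

Lemma continuous_family_reduced_product phi :
  Phi phi -> satisfies (reduced_product F A) phi.
Proof.
move=> Phiphi v.
pose w i x := reduced_repr (v x) i.
have -> : v = (fun x => reduced_class (fun i => w i x)).
  by apply/funext => x; rewrite -[LHS]reduced_reprK.
have ex := continuous_family_reduced_exists.
rewrite /equation_holds reduced_dist_eval// => vP.
by apply: continuous_family_theta => // j; move: (vP j); rewrite reduced_dist_eval.
Qed.

End ContinuousFamily.

(** * Limits of valuations in members of the class *)

Section UltraproductLimit.
Context {R : realType} {S : signature} (K : metric_algebra R S -> Prop).
Hypothesis KU : closed_under_ultraproducts K.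
Local Open Scope ereal_scope.

(** Any ultrafilter extending [F] will do. Strict lower bounds become weak in the limit, so each use
    starts from a bound above the one it needs. *)
Lemma ultraproduct_limit (I X : Type) (F : set_system I) {PF : ProperFilter F}
    (A : I -> metric_algebra R S) (v : forall i, X -> A i) :
  (forall i, K (A i)) ->
  exists (B : metric_algebra R S) (w : X -> B), [/\ K B,
    (forall s t (b : \bar R), 0 <= b ->
       F [set i | dist (eval (v i) s) (eval (v i) t) <= b] ->
       dist (eval w s) (eval w t) <= b) &
    (forall s t (b : \bar R),
       F [set i | b < dist (eval (v i) s) (eval (v i) t)] ->
       b <= dist (eval w s) (eval w t))].
Proof.
move=> KA; have [i0 _] := filter_ex (@filterT _ F _).
have [G [UG FG]] := ultraFilterLemma PF.
have [ex KG] := KU UG (inhabits i0) KA.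
exists (reduced_product G A), (fun x => reduced_class (fun i => v i x)).
split=> // s t b.
  by move=> b0 Fb; rewrite reduced_dist_eval//; apply: theta_le_near => //; exact: FG.
move=> Fb; rewrite reduced_dist_eval//; apply: theta_gt_near; last exact: FG.
exact: filter_not_empty.
Qed.

End UltraproductLimit.

(** * From the closure properties to an axiomatization *)

Section Axiomatization.
Context {R : realType} {S : signature} (K : metric_algebra R S -> Prop).

Definition basic_theory : set (metric_implication R S nat) :=
  [set phi | basic_quantitative_inference phi /\
             forall A, K A -> satisfies A phi].

Lemma basic_theory_continuous :
  closed_under_ultraproducts K -> continuous_family basic_theory.
Proof.
move=> KU; split=> [o|n prem s t eps eps' [basic Kphi] epseps'].
  split=> [i //|A _ v vP]; rewrite /equation_holds /=.
  suff -> : (fun k : 'I_(arity o) => v k.*2) =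
            (fun k : 'I_(arity o) => v k.*2.+1) by rewrite (dist_eq0 _ _).2.
  apply/funext => k; apply/dist_eq0/eqP; rewrite eq_le dist_ge0 andbT.
  exact: vP.
apply: contrapT => nod.
(* If no slack works, the slack 1/(m+1) has a counterexample in [K] for every m. *)
have /choice[Av AvP] : forall m : nat,
    exists Av : {A : metric_algebra R S & nat -> A}, [/\ K (projT1 Av),
      (forall i, equation_holds (projT2 Av)
                   (relax (m.+1%:R^-1)%:nng (prem i))) &
      (eps'%:num%:E <
        dist (eval (projT2 Av) s) (eval (projT2 Av) t))%E].
  move=> m; apply: contrapT => noAv; apply: nod.
  exists (m.+1%:R^-1)%:nng; split; first by rewrite /= invr_gt0.
  split=> [i|A KA v vP]; first exact: basic.
  rewrite /equation_holds leNgt; apply/negP => lt; apply: noAv.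
  by exists (existT _ A v).
have KAv m : K (projT1 (Av m)) by have [] := AvP m.
have [B [w [KB wle wge]]] :=
  ultraproduct_limit KU (F := \oo) (fun m => projT2 (Av m)) KAv.
have /(Kphi B KB w) : forall i, equation_holds w (prem i).
  move=> i; apply/lee_addgt0Pr => e e0; apply: wle.
    by rewrite -EFinD lee_fin addr_ge0// ltW.
  (* From this rank on, 1/e < m+1, so the slack is below e. *)
  exists (Num.trunc e^-1) => // m /= em.
  have [_ /(_ i) + _] := AvP m; move=> /le_trans; apply.
  rewrite -EFinD lee_fin lerD2l.
  by rewrite -[leRHS]invrK lef_pV2 ?posrE ?invr_gt0// ltW// -truncn_le_nat.
rewrite /equation_holds /= leNgt => /negP; apply.
apply: lt_le_trans (wge s t eps'%:num%:E _); first by rewrite lte_fin.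
by exists 0%N => // m _ /=; have [] := AvP m.
Qed.

Lemma finite_separation (A : metric_algebra R S)
    (Amod : forall phi, basic_theory phi -> satisfies A phi)
    (L : seq ({classic A} * {classic A})) (s t : term S A) (e : R) :
  0 <= e -> (e%:E < dist (eval id s) (eval id t))%E ->
  exists Bv : {B : metric_algebra R S & A -> B}, [/\ K (projT1 Bv),
    (forall a b : A, (a, b) \in L ->
       (dist (projT2 Bv a) (projT2 Bv b) <= dist a b)%E) &
    (e%:E < dist (eval (projT2 Bv) s) (eval (projT2 Bv) t))%E].
Proof.
move=> e0 est; apply: contrapT => noBv.
(* All elements of [A] that occur; their positions in this list number the variables of the
   inference [phi]. *)
pose V : seq {classic A} :=
  vars s ++ vars t ++ [seq p.1 | p <- L] ++ [seq p.2 | p <- L].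
pose h (a : {classic A}) : nat := index a V.
(* The default only has to be some element of [A]; the term [s] supplies one. *)
pose g n : A := nth (eval id s : {classic A}) V n.
have gh (a : {classic A}) : a \in V -> g (h a) = a 
  by move=> aV; rewrite /g /h nth_index.
(* A pair at infinite distance imposes no constraint, which is encoded by an
   equation between equal variables. *)
pose q (p : {classic A} * {classic A}) : {classic A} :=
  if dist (p.1 : A) p.2 == +oo%E then p.1 else p.2.
pose prem (i : 'I_(size L)) : metric_equation R S nat :=
  let p := tnth (in_tuple L) i in
  MetricEquation (Var (h p.1))
    (NngNum (fine_ge0 (dist_ge0 (p.1 : A) (p.2 : A)))) (Var (h (q p))).
pose phi := MetricImplication prem
  (MetricEquation (rename h s) (NngNum e0) (rename h t)).
have /Amod : basic_theory phi.
  split=> // B KB w wP; rewrite /equation_holds /= leNgt; apply/negP => lt.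
  apply: noBv; exists (existT _ B (w \o h)) => /=; split=> //; last first.
    by move: lt; rewrite 2!eval_rename.
  move=> a b /(tnthP (in_tuple L))[i abi].
  have := wP i; rewrite /equation_holds /= -abi /q /=.
  case: eqVneq => [->|aboo]; first by rewrite leey.
  by rewrite fineK// ge0_fin_numE ?dist_ge0// ltey.
(* Under [g] the variable numbered [h a] takes the value [a]: the premises hold in [A], and the
   conclusion contradicts [est]. *)
move=> /(_ g); rewrite /equation_holds /= 2!eval_rename.
have -> : eval (A := A) (g \o h) s = eval id s.
  apply: (@eq_eval_in _ {classic A}) => a aV /=.
  by apply: gh; rewrite mem_cat aV.
have -> : eval (A := A) (g \o h) t = eval id t.
  apply: (@eq_eval_in _ {classic A}) => a aV /=.
  by apply: gh; rewrite !mem_cat aV orbT.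
rewrite leNgt est => H; suff : false by []; apply: H => i.
set p := tnth (in_tuple L) i.
have pL : p \in L by exact: (mem_tnth i (in_tuple L)).
have p1V : p.1 \in V by rewrite !mem_cat (map_f fst pL) !orbT.
have p2V : p.2 \in V by rewrite !mem_cat (map_f snd pL) !orbT.
rewrite gh// /q; case: eqVneq => [_|poo]; rewrite gh//.
  by rewrite (dist_eq0 _ _).2// lee_fin fine_ge0// dist_ge0.
by rewrite fineK// ge0_fin_numE ?dist_ge0// ltey.
Qed.

Lemma separation (A : metric_algebra R S)
    (Amod : forall phi, basic_theory phi -> satisfies A phi)
    (s t : term S A) (e : R) :
  closed_under_ultraproducts K ->
  0 <= e -> (e%:E < dist (eval id s) (eval id t))%E ->
  exists Bv : {B : metric_algebra R S & A -> B}, [/\ K (projT1 Bv),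
    (forall a b : A, (dist (projT2 Bv a) (projT2 Bv b) <= dist a b)%E) &
    (e%:E < dist (eval (projT2 Bv) s) (eval (projT2 Bv) t))%E].
Proof.
move=> KU e0 est.
(* The gap between [e] and [e'] keeps the inequality strict after the limit. *)
have [e' ee' e'st] : exists2 e' : R, e < e' &
    (e'%:E < dist (eval id s) (eval id t))%E.
  move: est; case: (dist _ _) => [r| |]; rewrite ?lte_fin//.
    by move=> er; exists ((e + r) / 2); rewrite ?lte_fin midf_lt.
  by move=> _; exists (e + 1); rewrite ?ltry// ltrDl.
have /choice[Bv BvP] := fun L =>
  finite_separation Amod L (ltW (le_lt_trans e0 ee')) e'st.
(* Finite lists of pairs, ordered by inclusion: each pair of [A] is eventually constrained. *)
pose F := filter_from [set: seq ({classic A} * {classic A})]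
  (fun L0 => [set L : seq ({classic A} * {classic A}) | {subset L0 <= L}]).
have PF : ProperFilter F.
  apply: filter_from_proper; last by move=> L _; exists L => p.
  apply: filter_fromT_filter; first by exists [::].
  move=> L1 L2; exists (L1 ++ L2) => L L12; split=> p pL; apply: L12.
    by rewrite mem_cat pL.
  by rewrite mem_cat pL orbT.
have KBv L : K (projT1 (Bv L)) by have [] := BvP L.
have [B [w [KB wle wge]]] :=
  ultraproduct_limit KU (F := F) (fun L => projT2 (Bv L)) KBv.
exists (existT _ B w); split=> //= [a b|].
  apply: (wle (Var a) (Var b)); first exact: dist_ge0.
  exists [:: (a, b)] => // L abL /=; have [_ + _] := BvP L; apply.
  by apply: abL; rewrite inE.
apply: lt_le_trans (wge s t e'%:E _); first by rewrite lte_fin.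
by exists [::] => // L _ /=; have [] := BvP L.
Qed.

Lemma closed_class_of_separating (A : metric_algebra R S) :
  closed_under_subalgebras K -> closed_under_products K ->
  closed_under_reflexive_quotients K ->
  (forall (s t : term S A) (e : R),
    0 <= e -> (e%:E < dist (eval id s) (eval id t))%E ->
    exists Bv : {B : metric_algebra R S & A -> B}, [/\ K (projT1 Bv),
      (forall a b : A, (dist (projT2 Bv a) (projT2 Bv b) <= dist a b)%E) &
      (e%:E < dist (eval (projT2 Bv) s) (eval (projT2 Bv) t))%E]) ->
  K A.
Proof.
move=> KS KP KQ sep.
pose I := {i : (term S A * term S A) * R |
  0 <= i.2 /\ (i.2%:E < dist (eval id i.1.1) (eval id i.1.2))%E}.
have /choice[f fP] := fun i : I => sep _ _ _ (projT2 i).1 (projT2 i).2.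
pose P := product (fun i => projT1 (f i)).
pose v (a : A) : P := fun i => projT2 (f i) a.
have KPP : K P by apply: KP => i; have [] := fP i.
have vE (t : term S A) i : eval v t i = eval (projT2 (f i)) t.
  exact: (@eval_morph _ _ P (projT1 (f i)) (fun x => x i)).
have near a b : (dist (v a) (v b) <= dist a b)%E.
  apply: dsup_le => [|i _]; first exact: dist_ge0.
  by have [_ + _] := fP i; apply.
(* A smaller distance in [P] would be finite, and together with [s] and [t] it would be an index in
   [I], whose coordinate separates them by more than that distance. *)
have far s t : (dist (eval id s) (eval id t) <= dist (eval v s) (eval v t))%E.
  rewrite leNgt; apply/negP => lt.
  have fin : dist (eval v s) (eval v t) \is a fin_num.
    by rewrite ge0_fin_numE ?dist_ge0// (lt_le_trans lt)// leey.
  move: lt; rewrite -(fineK fin) => lt.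
  pose i : I := exist _ ((s, t), fine (dist (eval v s) (eval v t)))
    (conj (fine_ge0 (dist_ge0 _ _)) lt).
  have [_ _] := fP i; rewrite /= fineK// -!vE ltNge => /negP; apply.
  exact: (@dsup_ub _ _ setT (fun i => dist (eval v s i) (eval v t i))).
pose C : set P := [set x | exists t, x = eval v t].
have Cop : op_closed C.
  move=> o a /choice[t tP]; exists (App o t).
  by have -> : a = (fun k => eval v (t k)) by apply/funext.
have CP (x : subalgebra Cop) : exists t, val x = eval v t.
  exact: (set_mem (valP x)).
have /choice[tm tmP] := CP.
pose p (x : subalgebra Cop) : A := eval id (tm x).
(* By [far], terms with equal values in [P] have equal values in [A], so [p] does not depend on the
   chosen term. *)
have pE x t : val x = eval v t -> p x = eval id t.
  move=> xt; apply/dist_eq0/eqP; rewrite eq_le dist_ge0 andbT.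
  by apply: le_trans (far _ _) _; rewrite -tmP xt (dist_eq0 _ _).2.
pose gen t : subalgebra Cop := SigSub (mem_set (ex_intro _ t erefl : C (eval v t))).
have pgen t : p (gen t) = eval id t by exact: pE.
apply: (KQ (subalgebra Cop) A p); last exact: KS.
split; first split.
- split=> [o a|x y].
    apply: (pE _ (App o (fun k => tm (a k)))) => /=.
    by apply: functional_extensionality_dep => i; congr oper;
      apply/funext => k; rewrite tmP.
  by apply: le_trans (far _ _) _; rewrite -!tmP.
- by move=> a _; exists (gen (Var a)); rewrite ?pgen.
(* The generators are the isometric copy of [A]: [near] and [far] give the two inequalities. *)
exists [set x | exists a, val x = v a]; split; first split=> //.
- move=> x y /set_mem[a xa] /set_mem[b yb].
  rewrite (pE x (Var a))// (pE y (Var b))//= => ab.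
  by apply: val_inj; rewrite xa yb ab.
- by move=> a _; exists (gen (Var a)); rewrite ?pgen//; exists a.
- move=> x y [a xa] [b yb]; apply/eqP; rewrite eq_le; apply/andP; split.
    by apply: le_trans (far _ _) _; rewrite -!tmP.
  rewrite (pE x (Var a))// (pE y (Var b))//=.
  by rewrite /sub_dist xa yb; exact: near.
Qed.

End Axiomatization.

Theorem mainTheorem1 (R : realType) (S : signature)
    (K : metric_algebra R S -> Prop) (Kiso : closed_under_isomorphism K) :
  (exists Phi : set (metric_implication R S nat),
     [/\ continuous_family Phi,
         (forall phi, Phi phi -> basic_quantitative_inference phi)
       & defined_by K Phi]) <->
  [/\ closed_under_subalgebras K, closed_under_products K,
      closed_under_reflexive_quotients K & closed_under_ultraproducts K].
Proof.
split=> [[Phi [PhiC basic KPhi]]|[KS KP KQ KU]].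
  split.
  - move=> A B Bop /KPhi AP; apply/KPhi => phi /AP.
    exact: satisfies_subalgebra.
  - move=> I A KA; apply/KPhi => phi Phiphi; apply: satisfies_product => i.
    exact: (KPhi _).1 (KA i) _ Phiphi.
  - move=> A B p pq /KPhi AP; apply/KPhi => phi Phiphi.
    exact: satisfies_reflexive_quotient (basic _ Phiphi) pq (AP _ Phiphi).
  - move=> I F UF A _ KA.
    have AP i phi : Phi phi -> satisfies (A i) phi by exact: (KPhi _).1 (KA i) _.
    split; first exact: (continuous_family_reduced_exists PhiC (F := F) AP).
    by apply/KPhi => phi; exact: (continuous_family_reduced_product PhiC (F := F) AP).
exists (basic_theory K); split; first exact: basic_theory_continuous.
- by move=> phi [].
- move=> A; split=> [KA phi [_ Kphi]|Amod]; first exact: Kphi.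
  apply: closed_class_of_separating => // s t e.
  exact: separation.
Qed.
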